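(* Let $3\le m\le n$, $k\ge2$, and $L=\lfloor k/2\rfloor$. For $0\le s\le L$ let $Y_s$ be the set of points of $\mathcal Z^{m,n}_{2,k}$ at which $x^{(l)}_{i,j}=0$ for all $i,j$ and all $l<s$, and for $0\le s\le L-1$ let $X_s$ be the Zariski closure of the set of points of $Y_s$ at which some $x^{(s)}_{i,j}\neq0$. Then $\mathcal Z^{m,n}_{2,k}$ is reducible, and its irreducible components are exactly $X_0,X_1,\dots,X_{L-1}$ and $Y_L$ (all distinct). The component $X_s$ ($0\le s\le L-1$) has codimension $(m-1)(n-1)(k-2s)+mns$ in $\mathbf A^{mnk}$; $Y_L$ has codimension $mnL$ if $k=2L$, and $(m-1)(n-1)+mnL$ if $k=2L+1$.
   Context: Let $F$ be an algebraically closed field. For integers $1\le r\le m\le n$ and $k\ge 1$, let $S=F[x^{(l)}_{i,j}:1\le i\le m,\ 1\le j\le n,\ 0\le l\le k-1]$, the coordinate ring of $\mathbf A^{mnk}_F$, and let $X(t)$ be the $m\times n$ matrix over $S[t]/(t^k)$ with $(i,j)$ entry $x_{i,j}(t)=\sum_{l=0}^{k-1}x^{(l)}_{i,j}t^l$. Every element of $S[t]/(t^k)$ is uniquely $\sum_{l=0}^{k-1}c_lt^l$ with $c_l\in S$. $\mathcal I^{m,n}_{r,k}\subseteq S$ is the ideal generated by the coefficients of $t^l$, $0\le l\le k-1$, of all $r\times r$ minors of $X(t)$, and $\mathcal Z^{m,n}_{r,k}\subseteq\mathbf A^{mnk}_F$ is its zero set. The variable $x^{(l)}_{i,j}$ has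 degree $l$. *)

(* Defs.v *)
From HB Require Import structures.
From mathcomp Require Import all_boot all_order all_algebra.
From mathcomp Require Import mpoly.
Set Implicit Arguments. Unset Strict Implicit. Unset Printing Implicit Defensive.
Import GRing.Theory.
Local Open Scope ring_scope.

Section JetDeterminantal.
Variables (F : closedFieldType) (m n k : nat).

Definition coord := ('I_m * 'I_n * 'I_k)%type.
Definition nvars := #|{: coord}|.
Definition Spoly := {mpoly F[nvars]}.
Definition xvar (i : 'I_m) (j : 'I_n) (l : 'I_k) : Spoly := 'X_(enum_rank (i, j, l)).

Definition point := 'I_m -> 'I_n -> 'I_k -> F.
Definition pvec (x : point) : 'I_nvars -> F :=
  fun a => let: (i, j, l) := enum_val a in x i j l.
Definition peval (p : Spoly) (x : point) : F := p.@[pvec x].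

Definition pset := point -> Prop.
Definition psubset (A B : pset) := forall x, A x -> B x.

Definition zeroset (P : Spoly -> Prop) : pset := fun x => forall p, P p -> peval p x = 0.
Definition zclosed (A : pset) := exists P : Spoly -> Prop, A = zeroset P.
Definition zclosure (A : pset) : pset :=
  fun x => forall C, zclosed C -> psubset A C -> C x.
Definition irreducible (A : pset) :=
  (exists x, A x) /\
  forall C1 C2, zclosed C1 -> zclosed C2 -> psubset A (fun x => C1 x \/ C2 x) ->
    psubset A C1 \/ psubset A C2.
Definition irr_component (Z C : pset) :=
  psubset C Z /\ irreducible C /\
  forall D, irreducible D -> psubset C D -> psubset D Z -> D = C.

Definition irr_chain (c : nat -> pset) (d : nat) :=
  (forall i, i <= d -> zclosed (c i) /\ irreducible (c i))%N /\
  (forall i, i < d -> psubset (c i) (c i.+1) /\ c i <> c i.+1)%N.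
Definition has_dim (C : pset) (d : nat) :=
  (exists c, irr_chain c d /\ c d = C) /\
  ~ (exists c, irr_chain c d.+1 /\ c d.+1 = C).
Definition has_codim (C : pset) (e : nat) := exists d, has_dim C d /\ (d + e = m * n * k)%N.

Definition Xt : 'M[{poly Spoly}]_(m, n) :=
  \matrix_(i, j) \sum_(l < k) (xvar i j l)%:P * 'X^l.
(* generators of I^{m,n}_{r,k}: coefficients of t^l (l < k) of the r x r minors
   (rows f, columns g; non-injective f/g give 0 or repeat minors up to sign) *)
Definition minor_gens (r : nat) : Spoly -> Prop :=
  fun p => exists (f : 'I_r -> 'I_m) (g : 'I_r -> 'I_n) (l : 'I_k),
    p = (\det (\matrix_(a, b) Xt (f a) (g b)))`_l.
Definition Zset (r : nat) : pset := zeroset (minor_gens r).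

Definition Yset (s : nat) : pset :=
  fun x => Zset 2 x /\ forall i j (l : 'I_k), (l < s)%N -> x i j l = 0.
Definition Xset (s : nat) : pset :=
  zclosure (fun x => Yset s x /\ exists i j (l : 'I_k), val l = s /\ x i j l <> 0).

End JetDeterminantal.

Arguments irreducible {F m n k} A.
Arguments irr_component {F m n k} Z C.
Arguments has_codim {F m n k} C e.
Arguments Zset : clear implicits.
Arguments Yset : clear implicits.
Arguments Xset : clear implicits.

(* Main.v *)
(* With u_0 = 1, the points t^s (u v^T + t^(k-2s) w), where u v^T is taken modulo
   t^(k-2s), form a polynomial image of an affine space; its closure W_s (component s
   below) is therefore irreducible. A point of Y_s with x_(0,0)^(s) <> 0 has this form by
   division, and the other points of Y_s with x^(s) <> 0 are limits of such points along
   row and column operations. Hence W_s = X_s for s < L, W_L = Y_L, and the W_s cover Z.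
   No W_s lies in another W_t: for s < t because x^(s) vanishes on W_t, and for t < s
   because the 3 x 3 minors of the lifts to F[t] of the points of W_t vanish to order
   2k - t, whereas W_s contains diag(t^s, t^(k-s), t^(k-s), ...).
   The dimension is the number d of parameters: adding the parameters one at a time gives
   a chain of length d, and a chain of length N yields N polynomials that are algebraically
   independent on its top, so N <= d by counting monomials. *)
Require Import Defs.
From HB Require Import structures.
From Stdlib Require Import Classical FunctionalExtensionality PropExtensionality.
From mathcomp Require Import all_boot all_order all_algebra.
From mathcomp Require Import ring zify.
From mathcomp Require Import mpoly.
Set Implicit Arguments. Unset Strict Implicit. Unset Printing Implicit Defensive.
Import GRing.Theory.
Local Open Scope ring_scope.

(** * Zariski topology of the affine space *)

Lemma rmorph_mmap (F : comNzRingType) (N : nat) (R S : comNzRingType)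
    (h : F -> R) (h' : F -> S) (g : {rmorphism R -> S}) (v : 'I_N -> R) p :
  (forall a, g (h a) = h' a) -> g (mmap h v p) = mmap h' (fun i => g (v i)) p.
Proof.
move=> gh; rewrite /mmap rmorph_sum; apply: eq_bigr => e _.
rewrite rmorphM gh /mmap1 rmorph_prod; congr (_ * _).
by apply: eq_bigr => i _; rewrite rmorphXn.
Qed.

Lemma rmorph_mmap_meval (F : comNzRingType) (N : nat) (R : comNzRingType)
    (h : F -> R) (g : {rmorphism R -> F}) (v : 'I_N -> R) p :
  (forall a, g (h a) = a) -> g (mmap h v p) = p.@[fun i => g (v i)].
Proof. exact: rmorph_mmap. Qed.

Lemma poly_everywhere0 (F : closedFieldType) (p : {poly F}) :
  (forall a, p.[a] = 0) -> p = 0.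
Proof.
move=> p0; apply/eqP/negPn/negP => /closed_nonrootP[a].
by rewrite /root p0 eqxx.
Qed.

Section ZariskiTopology.
Variables (F : closedFieldType) (m n k : nat).
Local Notation point := (point F m n k).
Local Notation pset := (pset F m n k).
Local Notation Spoly := (Spoly F m n k).
Implicit Types (A B C : pset) (p q : Spoly) (x y : point).

Definition vanishes p A := forall x, A x -> peval p x = 0.

Lemma pset_ext A B : psubset A B -> psubset B A -> A = B.
Proof.
move=> AB BA; apply: functional_extensionality => x.
by apply: propositional_extensionality; split; [apply: AB | apply: BA].
Qed.

Lemma point_ext x y : (forall i j l, x i j l = y i j l) -> x = y.
Proof.
move=> xy; apply: functional_extensionality => i.
by apply: functional_extensionality => j; apply: functional_extensionality.
Qed.

Lemma pevalM p q x : peval (p * q) x = peval p x * peval q x.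
Proof. exact: rmorphM. Qed.

Lemma peval_xvar i j l x : peval (xvar F i j l) x = x i j l.
Proof. by rewrite /peval /xvar mevalXU /pvec enum_rankK. Qed.

Lemma zclosed_zeroset (P : Spoly -> Prop) : zclosed (zeroset P).
Proof. by exists P. Qed.

Lemma zclosed_vanish p : zclosed (fun x => peval p x = 0).
Proof.
exists (eq p); apply: pset_ext => x; first by move=> px q <-.
exact.
Qed.

(** The equations taken are all polynomials vanishing on some [C i], which avoids choosing a family
    of equations for each [i]. *)
Lemma zclosed_bigcap (I : Type) (C : I -> pset) :
  (forall i, zclosed (C i)) -> zclosed (fun x => forall i, C i x).
Proof.
move=> clC; exists (fun p => exists i, vanishes p (C i)).
apply: pset_ext => x; first by move=> Cx p [i]; apply.
move=> Px i; have [P defC] := clC i; rewrite defC => p Pp.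
by apply: Px; exists i => y; rewrite defC; apply.
Qed.

Lemma zclosedI A B : zclosed A -> zclosed B -> zclosed (fun x => A x /\ B x).
Proof.
move=> clA clB.
have := @zclosed_bigcap bool (fun b => if b then A else B).
case; first by case.
move=> P defP; exists P; rewrite -defP; apply: pset_ext => x.
  by move=> [Ax Bx] [].
by move=> ABx; split; [apply: (ABx true) | apply: (ABx false)].
Qed.

Lemma zclosedU A B : zclosed A -> zclosed B -> zclosed (fun x => A x \/ B x).
Proof.
move=> [P ->] [Q ->]; exists (fun r => exists p q, [/\ P p, Q q & r = p * q]).
apply: pset_ext => x.
  move=> [] Hx r [p [q [Pp Qq ->]]]; rewrite pevalM.
    by rewrite (Hx p Pp) mul0r.
  by rewrite (Hx q Qq) mulr0.
move=> PQx; have [Px | /not_all_ex_not[p Pp]] := classic (zeroset P x).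
  by left.
right=> q Qq; have [Pp' px] : P p /\ peval p x <> 0 by apply: imply_to_and.
have /eqP : peval (p * q) x = 0 by apply: PQx; exists p, q.
by rewrite pevalM mulf_eq0 => /orP[] /eqP.
Qed.

Lemma zclosed_zclosure A : zclosed (zclosure A).
Proof.
exists (fun p => vanishes p A); apply: pset_ext => x.
  by move=> Ax p pA; apply: (Ax (fun y => peval p y = 0)) => //; apply: zclosed_vanish.
by move=> Ax C [P ->] AC p Pp; apply: Ax => y /AC; apply.
Qed.

Lemma zclosure_incl A : psubset A (zclosure A).
Proof. by move=> x Ax C _; apply. Qed.

Lemma zclosure_min A C : zclosed C -> psubset A C -> psubset (zclosure A) C.
Proof. by move=> clC AC x; apply. Qed.

Lemma zclosure_sub A B : psubset A (zclosure B) -> psubset (zclosure A) (zclosure B).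
Proof. by apply: zclosure_min; apply: zclosed_zclosure. Qed.

Lemma vanishes_zclosure p A : vanishes p A -> vanishes p (zclosure A).
Proof. exact: (zclosure_min (zclosed_vanish p)). Qed.

Lemma irreducible_zclosure A : irreducible A -> irreducible (zclosure A).
Proof.
move=> [[x Ax] irrA]; split; first by exists x; apply: zclosure_incl.
move=> C1 C2 cl1 cl2 sub; have sA := @zclosure_incl A.
have [sub1|sub2] := irrA _ _ cl1 cl2 (fun x Ax => sub x (sA x Ax)).
  by left; apply: zclosure_min.
by right; apply: zclosure_min.
Qed.

Lemma irreducible_vanishesM A p q : irreducible A -> vanishes (p * q) A ->
  vanishes p A \/ vanishes q A.
Proof.
move=> [_ irrA] pqA; apply: irrA; [exact: zclosed_vanish.. | move=> x Ax].
by have /eqP := pqA x Ax; rewrite pevalM mulf_eq0 => /orP[] /eqP; [left|right].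
Qed.

Lemma irreducible_finite_cover (N : nat) (C : nat -> pset) A : irreducible A ->
  (forall i, zclosed (C i)) -> psubset A (fun x => exists2 i, (i < N)%N & C i x) ->
  exists2 i, (i < N)%N & psubset A (C i).
Proof.
move=> irrA clC; suff clU M : zclosed (fun x => exists2 i, (i < M)%N & C i x).
  elim: N => [|N IHN] sub; first by have [[x /sub[]]] := irrA.
  have [|/IHN[i ltiN AC]|AC] := irrA.2 _ _ (clU N) (clC N).
  - move=> x /sub[i]; rewrite ltnS leq_eqVlt => /orP[/eqP->|ltiN]; first by right.
    by left; exists i.
  - by exists i => //; apply: ltnW.
  - by exists N.
elim: M => [|M IHM].
  exists (eq 1); apply: pset_ext => x; first by case.
  by move=> /(_ _ (erefl 1)) /eqP; rewrite /peval rmorph1 oner_eq0.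
have [P defP] := zclosedU IHM (clC M); exists P; rewrite -defP.
apply: pset_ext => x.
  move=> [i]; rewrite ltnS leq_eqVlt => /orP[/eqP->|ltiM]; first by right.
  by left; exists i.
by move=> [[i ltiM]|]; [exists i => //; apply: ltnW | exists M].
Qed.

(** * Polynomial curves and irreducibility *)

Definition curve := 'I_m -> 'I_n -> 'I_k -> {poly F}.
Definition curve_at (c : curve) (a : F) : point := fun i j l => (c i j l).[a].

(** [R] is [{poly F}] for restriction to a curve and [{mpoly F[d]}] for pullback to a parameter
    space. *)
Definition psubst (R : comNzRingType) (h : F -> R) (c : 'I_m -> 'I_n -> 'I_k -> R)
    p : R :=
  mmap h (fun e => let: (i, j, l) := enum_val e in c i j l) p.

Lemma rmorph_psubst (R : comNzRingType) (h : F -> R) (g : {rmorphism R -> F}) c p :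
  (forall a, g (h a) = a) ->
  g (psubst h c p) = peval p (fun i j l => g (c i j l)).
Proof.
move=> gh; rewrite /psubst (rmorph_mmap_meval _ _ gh) /peval.
by apply: meval_eq => e; rewrite /pvec; case: (enum_val e) => [[i j] l].
Qed.

Lemma horner_psubst (c : curve) p a :
  (psubst polyC c p).[a] = peval p (curve_at c a).
Proof.
rewrite -[LHS]/(horner_eval a _) rmorph_psubst // => b.
exact: hornerC.
Qed.

(** Passage to the limit along a curve: if [p] vanishes on [A], its restriction to the curve times
    [q] vanishes everywhere, hence is zero, and [q] can be cancelled. *)
Lemma curve_in_zclosure (c : curve) (q : {poly F}) A : q != 0 ->
  (forall a, q.[a] != 0 -> zclosure A (curve_at c a)) ->
  forall a, zclosure A (curve_at c a).
Proof.
move=> q0 cA a C [P ->] AC p Pp; rewrite -horner_psubst.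
suff -> : psubst polyC c p = 0 by rewrite horner0.
apply: (mulIf q0); rewrite mul0r; apply: poly_everywhere0 => b.
rewrite hornerM horner_psubst; have [->|/cA cb] := eqVneq q.[b] 0.
  by rewrite mulr0.
by rewrite (cb (zeroset P)) ?mul0r //; apply: zclosed_zeroset.
Qed.

(** Polynomials nonzero at [x] and at [y] respectively stay nonzero on a curve joining [x] to [y],
    whereas their product would vanish along it; but F[t] is a domain. *)
Lemma irreducible_curve_connected A : (exists x, A x) ->
  (forall x y, A x -> A y -> exists c : curve,
     [/\ curve_at c 0 = x, curve_at c 1 = y & forall a, A (curve_at c a)]) ->
  irreducible A.
Proof.
move=> neA cA; split=> // _ _ [P ->] [Q ->] sub.
apply: NNPP => /not_or_and[/not_all_ex_not[x] nx /not_all_ex_not[y] ny].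
have [Ax /not_all_ex_not[p np]] := imply_to_and _ _ nx.
have [Ay /not_all_ex_not[q nq]] := imply_to_and _ _ ny.
have [Pp px] := imply_to_and _ _ np; have [Qq qy] := imply_to_and _ _ nq.
have [c [c0 c1 Ac]] := cA _ _ Ax Ay.
have pq0 : psubst polyC c p * psubst polyC c q = 0.
  apply: poly_everywhere0 => a; rewrite hornerM !horner_psubst.
  by have [/(_ p Pp)->|/(_ q Qq)->] := sub _ (Ac a); rewrite ?mul0r ?mulr0.
have /eqP := pq0; rewrite mulf_eq0 => /orP[] /eqP e0.
  by apply: px; rewrite -c0 -horner_psubst e0 horner0.
by apply: qy; rewrite -c1 -horner_psubst e0 horner0.
Qed.

Definition irredundant_cover (N : nat) (W : nat -> pset) (Z : pset) :=
  [/\ forall s, (s < N)%N -> irreducible (W s) /\ zclosed (W s),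
      forall s t, (s < N)%N -> (t < N)%N -> psubset (W s) (W t) -> s = t
    & forall x, Z x <-> exists2 s, (s < N)%N & W s x].

(** An irreducible subset of [Z] lies in a single [W s] by the finite covering lemma; irredundancy
    then makes each [W s] maximal. *)
Lemma irr_component_cover (N : nat) (W : nat -> pset) (Z C : pset) :
  irredundant_cover N W Z ->
  (irr_component Z C <-> exists2 s, (s < N)%N & C = W s).
Proof.
move=> [clW injW defZ].
have sub1 D : irreducible D -> psubset D Z -> exists2 s, (s < N)%N & psubset D (W s).
  move=> irrD DZ.
  (* The covering lemma asks for closed sets at every index, so the whole space is used from [N]
     on. *)
  pose W' s := if (s < N)%N then W s else (fun=> True).
  have [|x /DZ/defZ[s ltsN Wx]|s ltsN DW] :=
      @irreducible_finite_cover N W' D irrD.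
  - move=> s; rewrite /W'; case: ifP => [/clW[]//|_].
    by exists (fun=> False); apply: pset_ext => x // _ p.
  - by exists s; rewrite /W' ?ltsN.
  - by exists s => //; move: DW; rewrite /W' ltsN.
have WZ s : (s < N)%N -> psubset (W s) Z by move=> ltsN x Wx; apply/defZ; exists s.
split=> [[CZ [irrC maxC]]|[s ltsN ->]].
  have [s ltsN CW] := sub1 _ irrC CZ; exists s => //.
  by rewrite (maxC (W s)) //; [apply: (clW s ltsN).1 | apply: WZ].
split; first exact: WZ.
split; first exact: (clW s ltsN).1.
move=> D irrD WD DZ; have [t lttN DW] := sub1 _ irrD DZ.
have est : s = t by apply: injW => // x /WD /DW.
by apply: pset_ext => //; rewrite est.
Qed.

End ZariskiTopology.

(** * Algebraic independence and lengths of chains *)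

Local Notation widen := (widen_ord (leqnSn _)).

(** Isolates the last variable: [muni] reads a polynomial as univariate in it, with coefficients in
    the other variables. *)
Lemma mmap_muni (R S : comNzRingType) (h : {rmorphism R -> S}) (N : nat)
    (v : 'I_N.+1 -> S) (P : {mpoly R[N.+1]}) :
  mmap h v P =
    (map_poly (mmap h (fun i => v (widen i))) (muni P)).[v ord_max].
Proof.
rewrite muniE rmorph_sum /= horner_sum {1}/mmap; apply: eq_bigr => e _.
rewrite -!mul_polyC rmorphM /= map_polyC map_polyXn hornerM hornerC hornerXn.
rewrite /= mmapZ mmapX -mulrA; congr (_ * _).
rewrite /mmap1 big_ord_recr; congr (_ * _).
by apply: eq_bigr => i _; rewrite mnmE.
Qed.

(** Substituting the variables for themselves recovers [P] from [muni P]. *)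
Lemma muni_inj (R : comNzRingType) (N : nat) : injective (@muni N R).
Proof.
move=> P Q PQ.
have gen (T : {mpoly R[N.+1]}) :
    T = (map_poly (mmap (@mpolyC _ R) (fun i => 'X_(widen i))) (muni T)).['X_ord_max].
  rewrite -(@mmap_muni _ _ (@mpolyC _ R) _ (fun i => 'X_i)).
  rewrite -[LHS]comp_mpoly_id /comp_mpoly; apply: eq_bigr => e _; congr (_ * _).
  by apply: mmap1_eq => i; apply: tnth_mktuple.
by rewrite (gen P) (gen Q) PQ.
Qed.

Section AlgebraicDependence.
Variables (F : fieldType) (d : nat).

(** [msize] is the degree plus one, and 0 for the zero polynomial; a bound by [a.+1] thus means
    degree at most [a] and covers zero. *)
Lemma msizeM_degree (p q : {mpoly F[d]}) a b :
  (msize p <= a.+1 -> msize q <= b.+1 -> msize (p * q) <= (a + b).+1)%N.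
Proof.
have [->|p0] := eqVneq p 0; first by rewrite mul0r msize0.
have [->|q0] := eqVneq q 0; first by rewrite mulr0 msize0.
rewrite msizeM // => pa qb; rewrite -subn1 leq_subLR add1n.
by have := leq_add pa qb; rewrite addSn addnS.
Qed.

Lemma msize_exp_degree (p : {mpoly F[d]}) a e :
  (msize p <= a.+1 -> msize (p ^+ e) <= (a * e).+1)%N.
Proof.
move=> pa; elim: e => [|e IHe]; first by rewrite expr0 msize1.
by rewrite exprS mulnS; apply: msizeM_degree.
Qed.

Lemma msize_prod_degree (I : finType) (p : I -> {mpoly F[d]}) (a : I -> nat) :
  (forall i, msize (p i) <= (a i).+1)%N ->
  (msize (\prod_i p i) <= (\sum_i a i).+1)%N.
Proof.
move=> pa; elim/big_rec2: _ => [|i a' p' _ IH]; first by rewrite msize1.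
exact: msizeM_degree.
Qed.

(* With D large, the D^(d+1) monomials in the g i with exponents < D are more
   numerous than the monomials in d variables that can occur in them. *)
Lemma mpoly_algebraic_dependence (g : 'I_d.+1 -> {mpoly F[d]}) :
  exists2 P : {mpoly F[d.+1]}, P != 0 & mmap (@mpolyC _ F) g P = 0.
Proof.
pose c := (\max_i msize (g i))%N.
have gc i : (msize (g i) <= c.+1)%N by apply/leqW/leq_bigmax.
(* These values give [E <= D * w] and [w ^ d < D], hence E^d < D^(d+1). *)
pose w := (d.+1 * c).+1; pose D := (w ^ d).+1; pose E := (\sum_(i < d.+1) c * D).+1.
pose A := {ffun 'I_d.+1 -> 'I_D}; pose B := {ffun 'I_d -> 'I_E}.
pose amon (a : A) := [multinom (a i : nat) | i < d.+1].
pose bmon (b : B) := [multinom (b i : nat) | i < d].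
pose ga (a : A) := mmap1 g (amon a).
have ga_deg a : (msize (ga a) <= E)%N.
  apply: msize_prod_degree => i; apply: leq_trans (msize_exp_degree _ (gc i)) _.
  by rewrite ltnS leq_mul // mnmE ltnW.
(* Each row lists the coefficients of one monomial in the [g i]; a nonzero vector of the left kernel
   is the relation sought. *)
pose M := \matrix_(i < #|{: A}|, j < #|{: B}|) (ga (enum_val i))@_(bmon (enum_val j)).
have ltBA : (#|{: B}| < #|{: A}|)%N.
  rewrite !card_ffun !card_ord.
  have leE : (E <= D * w)%N by rewrite /E sum_nat_const card_ord /w mulnS; lia.
  apply: (@leq_ltn_trans ((D * w) ^ d)); first by case: (d) => // d'; rewrite leq_exp2r.
  by rewrite expnMn expnSr ltn_pmul2l ?expn_gt0.
have /rowV0Pn[r /sub_kermxP rM r0] : kermx M != 0.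
  rewrite -mxrank_eq0 mxrank_ker -lt0n subn_gt0.
  exact: leq_ltn_trans (rank_leq_col M) ltBA.
have amon_inj : injective amon.
  move=> a a' /mnmP aa'; apply/ffunP => i; apply: val_inj.
  by have := aa' i; rewrite !mnmE.
exists (\sum_i r 0 i *: 'X_[amon (enum_val i)]).
  apply: contra r0 => /eqP P0; apply/eqP/rowP => i; rewrite mxE.
  have /(congr1 (mcoeff (amon (enum_val i)))) := P0.
  rewrite mcoeff0 raddf_sum /= (bigD1 i) //= big1 ?addr0 => [|j ji].
    by rewrite mcoeffZ mcoeffX eqxx mulr1.
  by rewrite mcoeffZ mcoeffX (inj_eq amon_inj) (inj_eq enum_val_inj) (negPf ji) mulr0.
rewrite raddf_sum (eq_bigr (fun i => (r 0 i)%:MP * ga (enum_val i))); last first.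
  by move=> i _; apply: etrans (mmapZ _ _ _ _) _; rewrite mmapX.
apply/mpolyP => e; rewrite mcoeff0 raddf_sum /=.
under eq_bigr => i _ do rewrite mcoeffCM.
(* A monomial with an exponent at least [E] exceeds the degree of every [ga a], so it does not
   occur. *)
have [/forallP e_lt|/forallPn[j]] := boolP [forall j, e j < E]%N; last first.
  rewrite -leqNgt => Ee; apply: big1 => i _.
  rewrite memN_msupp_eq0 ?mulr0 //; apply: msize_mdeg_ge.
  apply: leq_trans (ga_deg _) (leq_trans Ee _).
  by rewrite mdegE (bigD1 j) //= leq_addr.
pose b : B := [ffun j => Ordinal (e_lt j)].
have <- : bmon b = e by apply/mnmP => j; rewrite mnmE ffunE.
have /rowP/(_ (enum_rank b)) := rM; rewrite !mxE; apply: etrans.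
by apply: eq_bigr => i _; rewrite mxE enum_rankK.
Qed.

End AlgebraicDependence.

(** * Chains of irreducible closed sets *)

Section Dimension.
Variables (F : closedFieldType) (m n k : nat).
Local Notation pset := (pset F m n k).
Local Notation Spoly := (Spoly F m n k).
Implicit Types (A B C : pset).

(** Independence of the restrictions to [A], that is, modulo the ideal of [A]. *)
Definition alg_indep (N : nat) (f : 'I_N -> Spoly) A :=
  forall P : {mpoly F[N]}, vanishes (mmap (@mpolyC _ F) f P) A -> P = 0.

(* A relation Q(f, g) = 0 on B restricts to Q(f, 0) = 0 on A, so Q has no
   constant term in its last variable and can be divided by it, as B is irreducible. *)
Lemma alg_indep_extend A B (N : nat) (f : 'I_N -> Spoly) g :
  irreducible B -> psubset A B -> vanishes g A -> ~ vanishes g B ->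
  alg_indep f A ->
  alg_indep (fun i : 'I_N.+1 => oapp f g (insub (val i) : option 'I_N)) B.
Proof.
move=> irrB AB gA gB indA; pose phi := mmap (@mpolyC _ F) f.
have indB (Q : {poly {mpoly F[N]}}) : vanishes (map_poly phi Q).[g] B -> Q = 0.
  elim/poly_ind: Q => // Q c IHQ.
  have -> : (map_poly phi (Q * 'X + c%:P)).[g] = (map_poly phi Q).[g] * g + phi c.
    by rewrite rmorphD rmorphM /= map_polyX map_polyC hornerD hornerC hornerMX.
  move=> QB.
  have c0 : c = 0.
    apply: indA => x Ax; have := QB x (AB x Ax).
    by rewrite /peval mevalD mevalM [meval _ g]gA // mulr0 add0r.
  have QB' : vanishes ((map_poly phi Q).[g] * g) B.
    by move=> x /QB; rewrite c0 [phi 0]mmap0 addr0.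
  have [/IHQ->|//] := irreducible_vanishesM irrB QB'.
  by rewrite c0 mul0r add0r polyC0.
set f' := fun i : 'I_N.+1 => _ => P.
have f'_last : f' ord_max = g by rewrite /f' insubN //= ltnn.
have f'_init : (fun i => f' (widen i)) = f.
  by apply: functional_extensionality => i; rewrite /f' valK.
rewrite mmap_muni f'_last f'_init => PB; apply: muni_inj.
by rewrite [RHS]rmorph0; apply: indB.
Qed.

(** Each strict inclusion provides a polynomial that vanishes on the smaller set but not on the
    larger one; it extends the family by one member. *)
Lemma chain_alg_indep (c : nat -> pset) (N : nat) : irr_chain c N ->
  exists f : 'I_N -> Spoly, alg_indep f (c N).
Proof.
elim: N => [|N IHN] [irr sub].
  (* In no variables [P] is a constant, and it is zero because [c 0] has a point. *)
  exists (fun=> 0) => P PB; have [_ [[x Cx] _]] := irr 0 (leqnn _).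
  have defP : P = (P@_0)%:MP.
    apply/mpolyP => e; rewrite mcoeffC; have -> : e = 0%MM by apply/mnmP => [[]].
    by rewrite eqxx mulr1.
  have := PB x Cx; rewrite defP mmapC /peval mevalC => ->.
  exact: mpolyC0.
have [|f indf] := IHN.
  by split=> i ltiN; [apply: irr; apply: leqW | apply: sub; apply: leqW].
have [[P defP] _] := irr N (leqnSn _); have [_ irrN1] := irr N.+1 (leqnn _).
have [subN neN] := sub N (leqnn _).
suff [g gN gN1] : exists2 g, vanishes g (c N) & ~ vanishes g (c N.+1).
  by eexists; apply: alg_indep_extend gN gN1 indf.
apply: NNPP => noG; apply: neN; apply: pset_ext => // x c1x; rewrite defP => p Pp.
apply: NNPP => px; apply: noG; exists p; last by move/(_ x c1x).
by move=> y; rewrite defP; apply.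
Qed.

(** The [d.+1] functions independent on the top of the chain pull back to polynomials in [d]
    parameters. Those satisfy a relation, which then vanishes on the image and on its closure. *)
Lemma chain_length_param (d : nat) (phi : 'I_m -> 'I_n -> 'I_k -> {mpoly F[d]}) c :
  psubset (c d.+1) (zclosure (fun x => exists v, x = fun i j l => (phi i j l).@[v])) ->
  ~ irr_chain c d.+1.
Proof.
move=> sub /chain_alg_indep[f indf].
have [P P0 Pf] := mpoly_algebraic_dependence (fun i => psubst (@mpolyC _ F) phi (f i)).
case/eqP: P0; apply: indf => x /sub; move: x.
apply: vanishes_zclosure => x [v ->].
rewrite -(@rmorph_psubst _ _ _ _ _ (@mpolyC _ F) (meval v) phi) => [|a]; last first.
  exact: mevalC.
rewrite /psubst (@rmorph_mmap _ _ _ _ _ (@mpolyC _ F)) => [|a]; last exact: mmapC.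
by rewrite Pf rmorph0.
Qed.

End Dimension.

(** * Truncated jets *)

Lemma dvdXnP (F : fieldType) (N : nat) (p : {poly F}) :
  reflect (forall i, (i < N)%N -> p`_i = 0) ('X^N %| p).
Proof.
apply: (iffP (dvdpP _ _)) => [[q ->] i ltiN|p0]; first by rewrite coefMXn ltiN.
exists (drop_poly N p); rewrite -[LHS](poly_take_drop N).
suff -> : take_poly N p = 0 by rewrite add0r.
by apply/polyP => i; rewrite coef_take_poly coef0; case: ifP => // /p0.
Qed.

Lemma det2 (R : comNzRingType) (A : 'M[R]_2) :
  \det A = A 0 0 * A 1 1 - A 0 1 * A 1 0.
Proof.
rewrite (expand_det_row _ 0) !big_ord_recl big_ord0 /cofactor !det_mx11 !mxE /=.
rewrite /bump /= !addr0 expr0 expr1 mul1r mulN1r mulrN.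
by congr (_ * A _ _ - A _ _ * A _ _); apply: val_inj.
Qed.

Lemma det3 (R : comNzRingType) (A : 'M[R]_3) :
  let a := fun i j : nat => A (inord i) (inord j) in
  \det A = a 0%N 0%N * (a 1%N 1%N * a 2%N 2%N - a 1%N 2%N * a 2%N 1%N)
         - a 0%N 1%N * (a 1%N 0%N * a 2%N 2%N - a 1%N 2%N * a 2%N 0%N)
         + a 0%N 2%N * (a 1%N 0%N * a 2%N 1%N - a 1%N 1%N * a 2%N 0%N).
Proof.
move=> a; have : forall i j : 'I_3, A i j = a i j by move=> i j; rewrite /a !inord_val.
move: a => a E; rewrite (expand_det_row _ 0) !big_ord_recl big_ord0 /cofactor !det2.
by rewrite !mxE !E /= /bump /=; ring.
Qed.

Section Jets.
Variables (F : closedFieldType) (m n k : nat).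
Implicit Types (x : point F m n k).

(** The lift of degree below [k] of an entry of X(t): congruences modulo t^k become divisibility by
    ['X^k]. *)
Definition jet (R : nzRingType) (y : 'I_m -> 'I_n -> 'I_k -> R) i j : {poly R} :=
  \sum_(l < k) y i j l *: 'X^l.

Lemma coef_jet (R : nzRingType) (y : 'I_m -> 'I_n -> 'I_k -> R) i j (l : 'I_k) :
  (jet y i j)`_l = y i j l.
Proof. by rewrite /jet coef_sumMXn (big_pred1 l). Qed.

Lemma coef_jet_ge (R : nzRingType) (y : 'I_m -> 'I_n -> 'I_k -> R) i j c :
  (k <= c)%N -> (jet y i j)`_c = 0.
Proof.
by move=> lekc; rewrite /jet coef_sumMXn big_pred0 // => l; have := ltn_ord l; lia.
Qed.

Lemma map_jet (R S : nzRingType) (g : {rmorphism R -> S})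
    (y : 'I_m -> 'I_n -> 'I_k -> R) i j :
  map_poly g (jet y i j) = jet (fun i j l => g (y i j l)) i j.
Proof.
rewrite rmorph_sum; apply: eq_bigr => l _ /=.
by rewrite map_polyZ map_polyXn.
Qed.

Lemma Xt_jet i j : Xt F m n k i j = jet (xvar F (k:=k)) i j.
Proof. by rewrite mxE; apply: eq_bigr => l _; rewrite mul_polyC. Qed.

Lemma peval_minor (r : nat) (f : 'I_r -> 'I_m) (g : 'I_r -> 'I_n) c x :
  peval (\det (\matrix_(a, b) Xt F m n k (f a) (g b)))`_c x =
  (\det (\matrix_(a, b) jet x (f a) (g b)))`_c.
Proof.
rewrite /peval -[LHS]coef_map -det_map_mx; congr (polyseq _)`_c; congr (\det _).
apply/matrixP => a b; rewrite [RHS]mxE [LHS]mxE [fun_of_matrix _ a b]mxE Xt_jet.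
rewrite [LHS]map_jet; congr (jet _ _ _).
by do 3![apply: functional_extensionality => ?]; apply: peval_xvar.
Qed.

Definition rank1_mod (K : nat) (Q : 'I_m -> 'I_n -> {poly F}) :=
  forall i i' j j', 'X^K %| Q i j * Q i' j' - Q i j' * Q i' j.

Lemma Zset2P x : Zset F m n k 2 x <-> rank1_mod k (jet x).
Proof.
split=> [Zx i i' j j'|rk1 p [f [g [l ->]]]].
  apply/dvdXnP => c ltck.
  pose f (a : 'I_2) := if a == 0 then i else i'.
  pose g (b : 'I_2) := if b == 0 then j else j'.
  have := Zx _ (ex_intro _ f (ex_intro _ g (ex_intro _ (Ordinal ltck) erefl))).
  by rewrite peval_minor det2 !mxE.
by rewrite peval_minor det2 !mxE; have /dvdXnP -> := rk1 (f 0) (f 1) (g 0) (g 1).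
Qed.

Definition shifted_jet s x i j := drop_poly s (jet x i j).

(** Factoring t^s out of all entries factors t^(2s) out of every 2 x 2 minor. *)
Lemma YsetP s x : (s + s <= k)%N ->
  Yset F m n k s x <->
  (forall i j, jet x i j = shifted_jet s x i j * 'X^s) /\
  rank1_mod (k - (s + s)) (shifted_jet s x).
Proof.
move=> le2sk.
have low : (forall i j (l : 'I_k), (l < s)%N -> x i j l = 0) <->
    (forall i j, jet x i j = shifted_jet s x i j * 'X^s).
  split=> [x0 i j|E i j l ltls]; last by rewrite -coef_jet E coefMXn ltls.
  rewrite -[LHS](poly_take_drop s) (_ : take_poly s _ = 0) ?add0r //.
  apply/polyP => c; rewrite coef_take_poly coef0; case: ifP => // ltcs.
  have ltck : (c < k)%N by lia.
  by rewrite (coef_jet x i j (Ordinal ltck)) x0.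
have minorE : (forall i j, jet x i j = shifted_jet s x i j * 'X^s) ->
    rank1_mod k (jet x) <-> rank1_mod (k - (s + s)) (shifted_jet s x).
  move=> E; pose q := shifted_jet s x.
  have qE i i' j j' : ('X^k %| jet x i j * jet x i' j' - jet x i j' * jet x i' j)
      = ('X^(k - (s + s)) %| q i j * q i' j' - q i j' * q i' j).
    rewrite !E -!/(q _ _) -{1}(subnK le2sk) !exprD.
    rewrite (_ : _ - _ = (q i j * q i' j' - q i j' * q i' j) * ('X^s * 'X^s));
      last by ring.
    by rewrite dvdp_mul2r // mulf_neq0 // expf_neq0 // polyX_eq0.
  by split=> H i i' j j'; [rewrite -qE | rewrite qE]; apply: H.
split=> [[/Zset2P Zx /low E]|[E rk1]]; first by split=> //; apply/(minorE E).
by split; [apply/Zset2P/(minorE E) | apply/low].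
Qed.

Lemma zclosed_Yset s : zclosed (Yset F m n k s).
Proof.
apply: zclosedI; first exact: zclosed_zeroset.
have [P defP] := @zclosed_bigcap F m n k {e : 'I_m * 'I_n * 'I_k | (e.2 < s)%N}
  (fun e x => peval (xvar F (val e).1.1 (val e).1.2 (val e).2) x = 0)
  (fun e => zclosed_vanish _).
exists P; rewrite -defP; apply: pset_ext => x.
  by move=> x0 [[[i j] l] /= ltls]; rewrite peval_xvar x0.
by move=> x0 i j l ltls; have := x0 (exist _ (i, j, l) ltls); rewrite peval_xvar.
Qed.

(** The 2 x 2 minors after a row or column operation are combinations of those before it. *)
Lemma Yset_row_col_op s (e : 'I_m -> F) (h : 'I_n -> F) i0 j0 x x' :
  (s + s <= k)%N ->
  (forall i j l, x' i j l =
     x i j l + e i * x i0 j l + h j * (x i j0 l + e i * x i0 j0 l)) ->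
  Yset F m n k s x -> Yset F m n k s x'.
Proof.
move=> le2sk x'E [/Zset2P Zx x0]; split; last first.
  by move=> i j l ltls; rewrite x'E !x0 // !(mulr0, addr0).
(* [P] is the matrix after the row operation alone. *)
pose P i j := jet x i j + (e i)%:P * jet x i0 j.
have jetE i j : jet x' i j = P i j + (h j)%:P * P i j0.
  apply/polyP => c; rewrite !(coefD, coefCM).
  have [ltck|lekc] := ltnP c k; last by rewrite !coef_jet_ge // !(mulr0, addr0).
  by rewrite !(fun y i j => coef_jet y i j (Ordinal ltck)) x'E.
have ZP : rank1_mod k P.
  move=> i i' j j'; rewrite (_ : _ - _ =
    (jet x i j * jet x i' j' - jet x i j' * jet x i' j)
    + (e i)%:P * (jet x i0 j * jet x i' j' - jet x i0 j' * jet x i' j)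
    + (e i')%:P * (jet x i j * jet x i0 j' - jet x i j' * jet x i0 j)); last first.
    by rewrite /P; ring.
  by apply: dvdp_add; [apply: dvdp_add|]; do ?[apply: Zx | apply: dvdp_mull].
apply/Zset2P => i i' j j'; rewrite !jetE (_ : _ - _ =
  (P i j * P i' j' - P i j' * P i' j)
  + (h j)%:P * (P i j0 * P i' j' - P i j' * P i' j0)
  + (h j')%:P * (P i j * P i' j0 - P i j0 * P i' j)); last by ring.
by apply: dvdp_add; [apply: dvdp_add|]; do ?[apply: ZP | apply: dvdp_mull].
Qed.

End Jets.

(** * The parametrized components *)

Lemma map_drop_poly (R S : nzRingType) (g : {rmorphism R -> S}) s p :
  map_poly g (drop_poly s p) = drop_poly s (map_poly g p).
Proof. by apply/polyP => c; rewrite coef_map !coef_drop_poly coef_map. Qed.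

Section Parametrization.
Variables (F : closedFieldType) (m n k : nat).
Local Notation point := (point F m.+1 n.+1 k).
Local Notation pset := (pset F m.+1 n.+1 k).
Implicit Types (x : point).

Section Def.
Variables (s : nat) (R : comNzRingType) (y : 'I_m.+1 -> 'I_n.+1 -> 'I_k -> R).

Definition col_vec i : {poly R} :=
  if i == ord0 then 1 else drop_poly s (jet y i ord0).
Definition row_vec j : {poly R} := drop_poly s (jet y ord0 j).

(* The point t^s (u v^T + t^(k-2s) w) with u_0 = 1, the coordinates of u, v and w
   being read off y at the positions where they occur in the result. *)
Definition param i j (l : 'I_k) : R :=
  if (l < s)%N then 0 else if (k - s <= l)%N then y i j l
  else (col_vec i * row_vec j)`_(l - s).

End Def.

(** Naturality in the ring: evaluating [param] on a curve or at generic coordinates amounts to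
    evaluating the coordinates first. *)
Lemma map_param s (R S : comNzRingType) (g : {rmorphism R -> S})
    (y : 'I_m.+1 -> 'I_n.+1 -> 'I_k -> R) i j l :
  g (param s y i j l) = param s (fun i j l => g (y i j l)) i j l.
Proof.
rewrite /param; case: ifP => _; first exact: rmorph0.
case: ifP => // _; rewrite -coef_map rmorphM; congr (polyseq (_ * _))`_(_).
  by rewrite /col_vec; case: ifP => _; rewrite ?rmorph1 // [LHS]map_drop_poly map_jet.
by rewrite /row_vec [LHS]map_drop_poly map_jet.
Qed.

(** The positions that [param] depends on: orders from [k - s] on hold w; below them, from order [s]
    on, the first row holds v and the rest of the first column holds u. *)
Definition param_coord s (p : 'I_m.+1 * 'I_n.+1 * 'I_k) :=
  (k - s <= p.2)%N || (s <= p.2)%N && ((p.1.1 == ord0) || (p.1.2 == ord0)).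

Lemma param_ext s (R : comNzRingType) (y y' : 'I_m.+1 -> 'I_n.+1 -> 'I_k -> R) :
  (forall i j l, param_coord s (i, j, l) -> y i j l = y' i j l) ->
  param s y = param s y'.
Proof.
move=> yy'; have E i j : (i == ord0) || (j == ord0) ->
    drop_poly s (jet y i j) = drop_poly s (jet y' i j).
  move=> ij0; apply/polyP => c; rewrite !coef_drop_poly.
  have [ltck|lekc] := ltnP (c + s) k; last by rewrite !coef_jet_ge.
  rewrite !(fun y i j => coef_jet y i j (Ordinal ltck)) yy' // /param_coord /=.
  by rewrite leq_addl ij0 orbT.
do 3![apply: functional_extensionality => ?]; rewrite /param.
case: ifP => // _; case: ifP => [lel|_]; first by rewrite yy' // /param_coord lel.
rewrite /col_vec /row_vec !(E ord0) //; case: ifP => // _.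
by rewrite E // orbT.
Qed.

Lemma param_mod s (y : point) i j : (s + s <= k)%N ->
  'X^(k - (s + s)) %| shifted_jet s (param s y) i j - col_vec s y i * row_vec s y j.
Proof.
move=> le2s; apply/dvdXnP => c ltc; rewrite coefB coef_drop_poly.
have ltck : (c + s < k)%N by lia.
rewrite (coef_jet _ i j (Ordinal ltck)) /param /= ltnNge leq_addl /=.
by rewrite ifF ?addnK ?subrr //; lia.
Qed.

(** An exact identity in F[t]: [r] absorbs w as well as the terms of u v^T beyond the truncation. *)
Lemma jet_param s (y : point) : (s + s <= k)%N -> exists r, forall i j,
  jet (param s y) i j =
  (col_vec s y i * row_vec s y j + r i j * 'X^(k - (s + s))) * 'X^s.
Proof.
move=> le2s; exists (fun i j =>
  (shifted_jet s (param s y) i j - col_vec s y i * row_vec s y j) %/ 'X^(k - (s + s))).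
move=> i j; rewrite divpK ?param_mod // addrC subrK.
rewrite -[LHS](poly_take_drop s) (_ : take_poly s _ = 0) ?add0r //.
apply/polyP => c; rewrite coef_take_poly coef0; case: ifP => // ltcs.
have ltck : (c < k)%N by lia.
by rewrite (coef_jet _ i j (Ordinal ltck)) /param ltcs.
Qed.

Lemma Yset_param s (y : point) : (s + s <= k)%N -> Yset F m.+1 n.+1 k s (param s y).
Proof.
move=> le2s; have [r E] := jet_param y le2s; apply/YsetP => //.
have qE i j : shifted_jet s (param s y) i j =
    col_vec s y i * row_vec s y j + r i j * 'X^(k - (s + s)).
  by rewrite /shifted_jet E drop_polyMXn_id.
split=> [i j|i i' j j']; first by rewrite qE E.
rewrite !qE; set z := 'X^_; set u := col_vec s y; set v := row_vec s y.
rewrite (_ : _ - _ = (u i * v j * r i' j' + r i j * (u i' * v j' + r i' j' * z)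
  - (u i * v j' * r i' j + r i j' * (u i' * v j + r i' j * z))) * z); last by ring.
exact: dvdp_mulIr.
Qed.

(** After division by t^s the entry q_(0,0) is a unit modulo t^(k-2s), and the vanishing minors give
    q = u v^T there with u_i = q_(i,0) / q_(0,0) and v_j = q_(0,j). *)
Lemma Yset_pivot_param s x (s_lt : (s < k)%N) : (s + s <= k)%N ->
  Yset F m.+1 n.+1 k s x -> x ord0 ord0 (Ordinal s_lt) != 0 ->
  exists y, x = param s y.
Proof.
move=> le2s /YsetP[]// E rk1 x00.
set K := (k - (s + s))%N in rk1; set q := shifted_jet s x in rk1.
have cop : coprimep 'X^K (q ord0 ord0).
  rewrite coprimep_expl // coprimep_sym coprimepX rootE horner_coef0.
  by rewrite coef_drop_poly add0n (coef_jet _ _ _ (Ordinal s_lt)).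
(* [b] is an inverse of [q ord0 ord0] modulo ['X^K]. *)
have /Bezout_eq1_coprimepP[[a b] /= ab1] := cop.
have bq : b * q ord0 ord0 = 1 - a * 'X^K by rewrite -ab1; ring.
have bqE i j : 'X^K %| b * q i ord0 * q ord0 j - q i j.
  rewrite -(Gauss_dvdpr _ cop).
  have -> : q ord0 ord0 * (b * q i ord0 * q ord0 j - q i j) =
      - (q ord0 ord0 * q i j - q ord0 j * q i ord0)
      + - (a * (q i ord0 * q ord0 j)) * 'X^K.
    transitivity (b * q ord0 ord0 * (q i ord0 * q ord0 j) - q ord0 ord0 * q i j).
      by ring.
    by rewrite bq; ring.
  by rewrite dvdp_add ?dvdp_mulIr // dvdpNr; apply: rk1.
pose u i := if i == ord0 then 1 else b * q i ord0.
have uq i j c : (c < K)%N -> (u i * q ord0 j)`_c = (q i j)`_c.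
  rewrite /u; case: eqP => [->|_] ltcK; first by rewrite mul1r.
  by apply/eqP; rewrite -subr_eq0 -coefB; apply/eqP; have /dvdXnP -> := bqE i j.
(* Below order [k - s] the first column outside row 0 is overwritten by [u]; the entries of [x] kept
   elsewhere supply v and w. *)
pose y : point := fun i j l =>
  if (l < k - s)%N && (j == ord0) && (i != ord0) then (u i)`_(l - s) else x i j l.
exists y; apply: point_ext => i j l; rewrite /param.
case: ifP => [ltls|/negbT]; first by rewrite -coef_jet E coefMXn ltls.
rewrite -leqNgt => lesl; case: ifP => [gel|/negbT]; first by rewrite /y ltnNge gel.
rewrite -ltnNge => ltl; have ltK : (l - s < K)%N by lia.
have yE i' j' c : (c < K)%N -> (drop_poly s (jet y i' j'))`_c =
    if (j' == ord0) && (i' != ord0) then (u i')`_c else (q i' j')`_c.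
  move=> ltcK; rewrite !coef_drop_poly; have ltck : (c + s < k)%N by lia.
  rewrite !(fun y i j => coef_jet y i j (Ordinal ltck)) /y /= addnK.
  by rewrite (_ : (c + s < k - s)%N) //; lia.
transitivity (u i * q ord0 j)`_(l - s).
  by rewrite uq // coef_drop_poly subnK // coef_jet.
rewrite !coefM; apply: eq_bigr => c _; congr (_ * _).
  rewrite /col_vec; case: eqP => [->|/eqP i0]; first by rewrite /u eqxx.
  by rewrite yE ?eqxx ?i0 //; have := ltn_ord c; lia.
by rewrite yE ?andbF //; lia.
Qed.
End Parametrization.

Lemma card_ord_interval k a b : (b <= k)%N ->
  #|[set l : 'I_k | a <= l < b]%N| = (b - a)%N.
Proof.
move=> lebk; rewrite cardsE -sum1_card.
rewrite (eq_bigl (fun l : 'I_k => (a <= l < b)%N)) //.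
rewrite -(big_mkord (fun l => (a <= l < b)%N) (fun=> 1%N)).
rewrite -[RHS]muln1 -sum_nat_const_nat [RHS](big_nat_widenl _ 0) //.
by rewrite [RHS](big_nat_widen _ _ k).
Qed.

(** * Slices of the parameter space *)

Section Components.
Variables (F : closedFieldType) (m n k : nat).
Local Notation point := (point F m.+1 n.+1 k).
Local Notation pset := (pset F m.+1 n.+1 k).
Local Notation coord := ('I_m.+1 * 'I_n.+1 * 'I_k)%type.
Implicit Types (x y : point).

Definition component s : pset := zclosure (fun x => exists y, x = param s y).

Lemma component_sub_Yset s : (s + s <= k)%N ->
  psubset (component s) (Yset F m.+1 n.+1 k s).
Proof.
move=> le2s; apply: zclosure_min; first exact: zclosed_Yset.
by move=> _ [y ->]; apply: Yset_param.
Qed.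

(* Adding tau times row i0 to row 0 and tau times column j0 to column 0 makes the
   entry (0, 0) of order s nonzero for all but finitely many tau. *)
Lemma Yset_leading_component s x i0 j0 (s_lt : (s < k)%N) : (s + s <= k)%N ->
  Yset F m.+1 n.+1 k s x -> x i0 j0 (Ordinal s_lt) != 0 -> component s x.
Proof.
move=> le2s Yx xij; pose de (i : nat) : F := (i == 0)%N%:R.
pose c : curve F m.+1 n.+1 k := fun i j l => (x i j l)%:P
  + (de i * x i0 j l + de j * x i j0 l) *: 'X + (de i * de j * x i0 j0 l) *: 'X^2.
have cE a i j l : curve_at c a i j l =
    x i j l + (a * de i) * x i0 j l + (a * de j) * (x i j0 l + (a * de i) * x i0 j0 l).
  by rewrite /curve_at /c !hornerE /=; ring.
have -> : x = curve_at c 0.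
  by apply: point_ext => i j l; rewrite cE !mul0r !addr0.
apply: (@curve_in_zclosure _ _ _ _ c (c ord0 ord0 (Ordinal s_lt))).
  apply: contraNneq xij => /(congr1 (fun p : {poly F} => p`_2)).
  by rewrite /c /de !coefE /= !mul1r !(mulr0, add0r, mulr1) => ->.
move=> a ca; apply: zclosure_incl; apply: Yset_pivot_param ca => //.
exact: Yset_row_col_op (cE a) Yx.
Qed.

(** The base point has v_0 = 1 and all other coordinates 0; with v_0 = 0 the first column would not
    show u. *)
Definition param_base s (i : 'I_m.+1) (j : 'I_n.+1) (l : 'I_k) : F :=
  ((i == ord0) && (j == ord0) && (l == s :> nat))%:R.

(** Image of a coordinate subspace through the base point; enlarging [ts] by one coordinate at a
    time yields the chain that bounds the dimension from below. *)
Definition slice s (ts : seq coord) : pset := fun x =>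
  exists2 y, (forall i j l, (i, j, l) \notin ts -> y i j l = param_base s i j l)
           & x = param s y.

(** [param] carries a segment between two parameters to a polynomial curve inside the slice. *)
Lemma irreducible_slice s ts : irreducible (slice s ts).
Proof.
apply: irreducible_curve_connected.
  by exists (param s (param_base s)), (param_base s).
move=> _ _ [y1 y1b ->] [y2 y2b ->].
pose y a : point := fun i j l => y1 i j l + a * (y2 i j l - y1 i j l).
pose c : curve F m.+1 n.+1 k :=
  param s (fun i j l => (y1 i j l)%:P + 'X * (y2 i j l - y1 i j l)%:P).
have cE a : curve_at c a = param s (y a).
  apply: point_ext => i j l; rewrite /curve_at -[LHS]/(horner_eval a _) map_param.
  congr (param s _ i j l); do 3![apply: functional_extensionality => ?].
  by rewrite /= /horner_eval !hornerE.
exists c; rewrite !cE; split=> [||a].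
- by congr (param s _); apply: point_ext => i j l; rewrite /y mul0r addr0.
- by congr (param s _); apply: point_ext => i j l; rewrite /y mul1r addrC subrK.
rewrite cE; exists (y a) => // i j l nts.
by rewrite /y y1b // y2b // subrr mulr0 addr0.
Qed.

Lemma sub_slice s ts ts' : {subset ts <= ts'} -> psubset (slice s ts) (slice s ts').
Proof.
move=> sub x [y yb ->]; exists y => // i j l nts'; apply: yb.
by apply: contra nts'; apply: sub.
Qed.

(** In the first row u_0 = 1 leaves v_j; in the first column the entry u_i v_0 is u_i once v_0 =
    1. *)
Lemma param_entry s y i j l : (s + s <= k)%N -> param_coord s (i, j, l) ->
  (i = ord0 /\ j = ord0) \/ (forall l', y ord0 ord0 l' = param_base s ord0 ord0 l') ->
  param s y i j l = y i j l.
Proof.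
rewrite /param_coord /param /= => le2s; case: (leqP (k - s) l) => /= [gel _ _|ltl].
  by rewrite ifF //; lia.
move=> /andP[lesl ij0] y00; rewrite ltnNge lesl /= /col_vec /row_vec.
case: eqP ij0 => [-> _|i0 /= /eqP j0].
  by rewrite mul1r coef_drop_poly subnK // coef_jet.
have {}y00 l' : y ord0 ord0 l' = param_base s ord0 ord0 l' by case: y00 => [[]|].
suff -> : drop_poly s (jet y ord0 j) = 1.
  by rewrite mulr1 coef_drop_poly subnK // coef_jet j0.
apply/polyP => c; rewrite coef_drop_poly coef1 j0.
have [ltck|lekc] := ltnP (c + s) k.
  rewrite (coef_jet _ _ _ (Ordinal ltck)) y00 /param_base !eqxx /=.
  by rewrite -{2}[s]add0n eqn_add2r.
rewrite coef_jet_ge // (_ : (c == 0)%N = false) //.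
by have := ltn_ord l; lia.
Qed.

(* The coordinates of v_0 come last: as long as v_0 = 1, the entry x_(i, 0) is u_i. *)
Definition param_seq s : seq coord :=
  let pivot := fun p : coord => p.1 == (ord0, ord0) in
  let ps := enum (param_coord s) in
  filter (predC pivot) ps ++ filter pivot ps.

Lemma perm_param_seq s : perm_eq (param_seq s) (enum (param_coord s)).
Proof.
by rewrite perm_sym -(perm_filterC (fun p : coord => p.1 == (ord0, ord0))) perm_catC.
Qed.

Lemma mem_param_seq s p : (p \in param_seq s) = param_coord s p.
Proof. by rewrite (perm_mem (perm_param_seq s)) mem_enum. Qed.

Lemma uniq_param_seq s : uniq (param_seq s).
Proof. by rewrite (perm_uniq (perm_param_seq s)) enum_uniq. Qed.

Lemma slice_param_seq s : slice s (param_seq s) = fun x => exists y, x = param s y.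
Proof.
apply: pset_ext => x; first by move=> [y _ ->]; exists y.
move=> [y ->].
exists (fun i j l => if param_coord s (i, j, l) then y i j l else param_base s i j l).
  by move=> i j l; rewrite mem_param_seq => /negPf->.
by apply: param_ext => i j l ->.
Qed.

Lemma irreducible_component s : irreducible (component s).
Proof.
by apply: irreducible_zclosure; rewrite -slice_param_seq; apply: irreducible_slice.
Qed.

(** When a coordinate outside position (0, 0) is freed, none at (0, 0) is free yet, so v_0 is still
    1. *)
Lemma param_seq_entry s y N p0 : (s + s <= k)%N -> (N < size (param_seq s))%N ->
  (forall i j l, (i, j, l) \notin take N.+1 (param_seq s) ->
     y i j l = param_base s i j l) ->
  let: (i, j, l) := nth p0 (param_seq s) N in param s y i j l = y i j l.
Proof.
move=> le2s ltN yb; case def_p: (nth p0 _ N) => [[i j] l].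
have := mem_nth p0 ltN; rewrite def_p => p_in.
apply: param_entry => //; first by rewrite -mem_param_seq.
have [/eqP[-> ->]|ij0] := boolP ((i, j) == (ord0, ord0)); first by left.
right=> l'; apply: yb; move: def_p ij0; rewrite /param_seq nth_cat take_cat.
set s1 := filter _ _; case: (ltnP N (size s1)) => [ltN1 _ _|geN1].
  apply/negP => in1; have: (ord0, ord0, l') \in s1.
    case: ifP in1 => [_ /mem_take//|_]; rewrite mem_cat => /orP[//|].
    by rewrite (_ : (N.+1 - _ = 0)%N) ?take0 //; lia.
  by rewrite mem_filter /= ?eqxx.
set s2 := filter _ _ => def_p /negP[].
have ltN2 : (N < size s1 + size s2)%N by rewrite -size_cat.
have: nth p0 s2 (N - size s1) \in s2 by apply: mem_nth; rewrite ltn_subLR.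
by rewrite def_p mem_filter => /andP[].
Qed.

End Components.

(** * Dimension and codimension of the components *)

Section Codimension.
Variables (F : closedFieldType) (m n k : nat).
Local Notation point := (point F m.+1 n.+1 k).
Local Notation pset := (pset F m.+1 n.+1 k).
Local Notation coord := ('I_m.+1 * 'I_n.+1 * 'I_k)%type.
Local Notation component := (@component F m n k).
Local Notation param_seq := (@param_seq m n k).

Lemma zclosed_coord (i : 'I_m.+1) (j : 'I_n.+1) (l : 'I_k) (b : F) :
  zclosed (fun x : point => x i j l = b).
Proof.
have [P defP] := zclosed_vanish (xvar F i j l - b%:MP).
exists P; rewrite -defP; apply: pset_ext => x.
  by move=> xb; rewrite /peval mevalB mevalC [meval _ _]peval_xvar xb subrr.
by rewrite /peval mevalB mevalC [X in X - _]peval_xvar => /eqP; rewrite subr_eq0 => /eqP.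
Qed.

(** The coordinate freed at each step is an entry of the point, constant on the smaller slice but
    not on the larger one. *)
Lemma slice_chain s : (s + s <= k)%N ->
  irr_chain (fun N => zclosure (slice s (take N (param_seq s)) : pset)) (size (param_seq s)).
Proof.
move=> le2s; split=> [N _|N ltN].
  split; first exact: zclosed_zclosure.
  by apply: irreducible_zclosure; apply: irreducible_slice.
have sub_take : {subset take N (param_seq s) <= take N.+1 (param_seq s)}.
  by move=> p; rewrite -(take_takel _ (leqnSn N)) => /mem_take.
split.
  by apply: zclosure_sub => x xN; apply: zclosure_incl; apply: sub_slice xN.
have p0 : coord by case: (param_seq s) ltN => [|p0].
have entry y := @param_seq_entry F m n k s y N p0 le2s ltN.
have : nth p0 (param_seq s) N \notin take N (param_seq s).
  have := take_uniq N.+1 (uniq_param_seq m n k s).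
  by rewrite (take_nth p0) // rcons_uniq => /andP[].
have : nth p0 (param_seq s) N \in take N.+1 (param_seq s).
  by rewrite (take_nth p0) // mem_rcons mem_head.
move: entry; case: (nth p0 _ N) => [[i j] l] entry inN1 ninN eqN.
(* The base point moved by 1 in the new coordinate, hence off a hyperplane that contains the smaller
   slice. *)
pose y1 : point := fun i' j' l' => param_base F s i' j' l' + ((i', j', l') == (i, j, l))%:R.
have y1b i' j' l' : (i', j', l') \notin take N.+1 (param_seq s) ->
    y1 i' j' l' = param_base F s i' j' l'.
  by rewrite /y1; case: eqP => [-> /negP|_]; rewrite ?addr0.
have : zclosure (slice s (take N (param_seq s)) : pset) (param s y1).
  by rewrite eqN; apply: zclosure_incl; exists y1.
move=> /(_ _ (zclosed_coord i j l (param_base F s i j l))).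
rewrite entry // /y1 eqxx => E.
have /eqP : param_base F s i j l + 1 = param_base F s i j l.
  apply: E => _ [y yb ->]; rewrite entry ?yb // => i' j' l' nin; apply: yb.
  by apply: contra nin; apply: sub_take.
by rewrite -subr_eq0 addrC addKr oner_eq0.
Qed.

Lemma has_dim_component s : (s + s <= k)%N -> has_dim (component s) (size (param_seq s)).
Proof.
move=> le2s; set d := size _; split.
  exists (fun N => zclosure (slice s (take N (param_seq s)))); split.
    exact: slice_chain.
  by rewrite take_size slice_param_seq.
move=> [c [chain cW]]; move: chain.
(* The generic parameter: an indeterminate at each position of [param_seq s], and 0, as an empty
   sum, elsewhere. *)
pose Y (i : 'I_m.+1) (j : 'I_n.+1) (l : 'I_k) : {mpoly F[d]} :=
  \sum_(a < d | tnth (in_tuple (param_seq s)) a == (i, j, l)) 'X_a.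
apply: (@chain_length_param _ _ _ _ d (param s Y)); rewrite cW.
apply: zclosure_sub => _ [y ->]; apply: zclosure_incl.
pose v a := let: (i, j, l) := tnth (in_tuple (param_seq s)) a in y i j l.
exists v; do 3![apply: functional_extensionality => ?]; rewrite [RHS]map_param.
congr (_ _ _ _); apply: param_ext => i j l; rewrite -(mem_param_seq s) => p_in.
have [a def_a] : exists a, tnth (in_tuple (param_seq s)) a = (i, j, l).
  by have /tnthP[a ->] : (i, j, l) \in in_tuple (param_seq s) by []; exists a.
rewrite /Y (big_pred1 a) /=; last first.
  move=> b; rewrite -def_a; apply/eqP/eqP => [|->//].
  by apply/tuple_uniqP; exact: (uniq_param_seq m n k s).
by rewrite mevalXU /v def_a.
Qed.

(** The remaining positions are the orders below [s] of all entries and, off the first row and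
    column, the orders from [s] up to but excluding [k - s]. *)
Lemma card_not_param_coord s : (s + s <= k)%N ->
  #|predC (@param_coord m n k s)| = (m * n * (k - 2 * s) + m.+1 * n.+1 * s)%N.
Proof.
move=> le2s.
pose low : {set coord} := setX [set: 'I_m.+1 * 'I_n.+1] [set l : 'I_k | 0 <= l < s]%N.
pose mid : {set coord} :=
  setX (setX [set~ ord0] [set~ ord0]) [set l : 'I_k | s <= l < k - s]%N.
have -> : #|predC (@param_coord m n k s)| = #|mid :|: low|.
  apply: eq_card => [[[i j] l]]; rewrite !inE /= /param_coord /=.
  have := ltn_ord l; case: (i == ord0); case: (j == ord0); lia.
rewrite cardsU (_ : mid :&: low = set0) ?cards0 ?subn0.
  rewrite !cardsX !cardsC1 cardsT !card_ord card_prod !card_ord.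
  by rewrite !card_ord_interval; lia.
by apply/setP => [[[i j] l]]; rewrite !inE /=; lia.
Qed.

Lemma has_codim_component s : (s + s <= k)%N ->
  has_codim (component s) (m * n * (k - 2 * s) + m.+1 * n.+1 * s)%N.
Proof.
move=> le2s; exists (size (param_seq s)); split; first exact: has_dim_component.
rewrite -card_not_param_coord // (perm_size (perm_param_seq m n k s)) -cardE.
by rewrite (cardC (@param_coord m n k s)) !card_prod !card_ord.
Qed.

End Codimension.

(** In the expansion in powers of z, the coefficients of 1 and z involve minors of u v^T of size 3
    and 2, which are zero. The witness collects the z^2 and z^3 terms. *)
Lemma det3_rank1_perturbation (R : comNzRingType) (u v : 'I_3 -> R)
    (r : 'I_3 -> 'I_3 -> R) z :
  exists q, \det (\matrix_(a, b) (u a * v b + r a b * z)) = q * (z * z).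
Proof.
rewrite det3 !mxE.
pose u' a := u (inord a); pose v' b := v (inord b); pose r' a b := r (inord a) (inord b).
rewrite -!/(u' _) -!/(v' _) -!/(r' _ _).
move: (u' 0%N) (u' 1%N) (u' 2%N) (v' 0%N) (v' 1%N) (v' 2%N) => u0 u1 u2 v0 v1 v2.
move: (r' 0%N 0%N) (r' 0%N 1%N) (r' 0%N 2%N) (r' 1%N 0%N) (r' 1%N 1%N) (r' 1%N 2%N)
  (r' 2%N 0%N) (r' 2%N 1%N) (r' 2%N 2%N) => r00 r01 r02 r10 r11 r12 r20 r21 r22.
exists (u0 * v0 * (r11 * r22 - r12 * r21)
  - u0 * v1 * (r10 * r22 - r12 * r20) + u0 * v2 * (r10 * r21 - r11 * r20)
  - u1 * v0 * (r01 * r22 - r02 * r21) + u1 * v1 * (r00 * r22 - r02 * r20)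
  - u1 * v2 * (r00 * r21 - r01 * r20) + u2 * v0 * (r01 * r12 - r02 * r11)
  - u2 * v1 * (r00 * r12 - r02 * r10) + u2 * v2 * (r00 * r11 - r01 * r10)
  + z * (r00 * (r11 * r22 - r12 * r21) - r01 * (r10 * r22 - r12 * r20)
    + r02 * (r10 * r21 - r11 * r20))).
ring.
Qed.

(** * The components cover the zero set irredundantly *)

Section Decomposition.
Variables (F : closedFieldType) (m n k : nat).
Local Notation point := (point F m.+1 n.+1 k).
Local Notation pset := (pset F m.+1 n.+1 k).
Local Notation component := (@component F m n k).
Implicit Types (x : point).

Lemma Xset_component s : (s + s <= k)%N -> (s < k)%N ->
  Xset F m.+1 n.+1 k s = component s.
Proof.
move=> le2s s_lt; apply: pset_ext.
  apply: zclosure_min; first exact: zclosed_zclosure.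
  move=> x [Yx [i [j [l [ls xl]]]]].
  apply: (@Yset_leading_component _ _ _ _ _ _ i j s_lt) => //.
  by apply/eqP; rewrite (_ : Ordinal s_lt = l) //; apply: val_inj; rewrite /= ls.
apply: zclosure_sub => _ [y ->].
(* Only the coordinate (0, 0) of order [s] moves. It is also an entry of the point, so the
   nonvanishing required in [Xset] fails for a single value of the curve parameter. *)
pose yc (i : 'I_m.+1) (j : 'I_n.+1) (l : 'I_k) : {poly F} :=
  (y i j l)%:P + ((i == ord0) && (j == ord0) && (l == s :> nat))%:R *: 'X.
pose y_ a : point := fun i j l =>
  y i j l + a * ((i == ord0) && (j == ord0) && (l == s :> nat))%:R.
have cE a : curve_at (param s yc) a = param s (y_ a).
  apply: point_ext => i j l; rewrite /curve_at -[LHS]/(horner_eval a _) map_param.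
  congr (param s _ i j l); do 3![apply: functional_extensionality => ?].
  by rewrite /= /horner_eval !hornerE /y_ mulrC.
have -> : param s y = curve_at (param s yc) 0.
  by rewrite cE; congr (param s _); apply: point_ext => i j l; rewrite /y_ mul0r addr0.
pose q : {poly F} := 'X + (y ord0 ord0 (Ordinal s_lt))%:P.
apply: (@curve_in_zclosure _ _ _ _ _ q) => [|a].
  by rewrite -size_poly_eq0 size_XaddC.
rewrite hornerD hornerX hornerC => qa; rewrite cE; apply: zclosure_incl.
split; first exact: Yset_param.
exists ord0, ord0, (Ordinal s_lt); split=> //.
rewrite param_entry //; last by left.
  by rewrite /y_ !eqxx mulr1 addrC; apply/eqP.
by rewrite /param_coord /= leqnn orbT.
Qed.

Lemma Yset_half_component : (0 < k)%N -> Yset F m.+1 n.+1 k k./2 = component k./2.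
Proof.
move=> k_gt0; set L := k./2; have le2L : (L + L <= k)%N by rewrite /L; lia.
apply: pset_ext; last exact: component_sub_Yset.
move=> x Yx; have L_lt : (L < k)%N by rewrite /L; lia.
have [[i [j xL]]|no] := classic (exists i j, x i j (Ordinal L_lt) != 0).
  exact: Yset_leading_component xL.
(* With x^(L) = 0 the point is its own parameter: orders from [k - L] on are free, and order L lies
   below them only for odd [k], where it is the constant term of u v^T and vanishes. *)
apply: zclosure_incl; exists x; apply: point_ext => i j l; rewrite /param.
case: ifP => [ltl|/negbT gel]; first by rewrite Yx.2.
case: ifP => // /negbT ltl.
have xL0 i' j' : x i' j' (Ordinal L_lt) = 0.
  by apply/eqP/negPn/negP => xL; apply: no; exists i', j'.
have lL : l = L :> nat by rewrite /L in gel ltl *; lia.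
rewrite (_ : l = Ordinal L_lt) ?xL0; last exact: val_inj.
rewrite /= subnn coef0M /row_vec [X in _ * X]coef_drop_poly add0n.
by rewrite (coef_jet _ _ _ (Ordinal L_lt)) xL0 mulr0.
Qed.

(* The lifted matrix is t^s (u v^T + t^(k-2s) r) over F[t], and the 3 x 3 minors of
   u v^T + z r are divisible by z^2. *)
Lemma component_minor3 s (f : 'I_3 -> 'I_m.+1) (g : 'I_3 -> 'I_n.+1) c :
  (s + s <= k)%N -> (c < k + k - s)%N ->
  psubset (component s) (fun x => (\det (\matrix_(a, b) jet x (f a) (g b)))`_c = 0).
Proof.
move=> le2s ltc.
have [P defP] := zclosed_vanish
  (\det (\matrix_(a, b) Xt F m.+1 n.+1 k (f a) (g b)))`_c.
apply: zclosure_min.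
  by exists P; rewrite -defP; apply: pset_ext => x; rewrite peval_minor.
move=> _ [y ->]; have [r E] := jet_param y le2s.
pose M := \matrix_(a < 3, b < 3) (col_vec s y (f a) * row_vec s y (g b)
  + r (f a) (g b) * 'X^(k - (s + s))).
rewrite (_ : \matrix_(a, b) _ = 'X^s *: M); last first.
  by apply/matrixP => a b; rewrite !mxE E mulrC.
have [q defM] := det3_rank1_perturbation (fun a => col_vec s y (f a))
  (fun b => row_vec s y (g b)) (fun a b => r (f a) (g b)) 'X^(k - (s + s)).
(* The exponent is 3s + 2(k - 2s) = 2k - s. *)
rewrite detZ defM mulrC -mulrA -!exprD -exprM -exprD coefMXn ifT //; lia.
Qed.

(* diag(t^s, t^(k-s), t^(k-s), ...) has a 3 x 3 minor of order exactly 2k - s,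
   which component_minor3 excludes on component t for t < s. *)
Definition diag_exp (s i : nat) := if i is 0%N then s else (k - s)%N.
Definition diag_point (s : nat) : point := fun i j l =>
  ((i == j :> nat) && (l == diag_exp s i :> nat))%:R.

(** For s = 0 the exponent k - s equals k and is truncated away, hence the test on
    [diag_exp s i]. *)
Lemma jet_diag_point s i j : jet (diag_point s) i j =
  if (i == j :> nat) && (diag_exp s i < k)%N then 'X^(diag_exp s i) else 0.
Proof.
apply/polyP => c; have [ltck|lekc] := ltnP c k.
  rewrite (coef_jet _ i j (Ordinal ltck)) /diag_point /=.
  case: (i == j :> nat) => /=; last by rewrite coef0.
  case: ifP => [_|nlt]; first by rewrite coefXn.
  by rewrite coef0; case: eqP => // ce; lia.
rewrite coef_jet_ge //; case: ifP => [/andP[_ lt]|_]; rewrite ?coef0 // coefXn.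
by case: eqP => // ce; lia.
Qed.

Lemma Yset_diag_point s : (s + s <= k)%N -> Yset F m.+1 n.+1 k s (diag_point s).
Proof.
move=> le2s; split; last first.
  move=> i j l ltls; rewrite /diag_point; case: eqP => //= _; case: eqP => // le.
  by move: le ltls; rewrite /diag_exp; case: (val i); lia.
(* Two distinct rows have exponents with sum k or 2(k - s), which is at least k. *)
have dvd (i i' : 'I_m.+1) (j j' : 'I_n.+1) : i != i' ->
    'X^k %| jet (diag_point s) i j * jet (diag_point s) i' j'.
  move=> ii'; rewrite !jet_diag_point.
  case: ifP => _; last by rewrite mul0r dvdp0.
  case: ifP => _; last by rewrite mulr0 dvdp0.
  rewrite -exprD; apply: dvdp_exp2l.
  by move: ii'; rewrite -val_eqE /diag_exp /=; case: (val i) (val i') => [|?] [|?]; lia.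
apply/Zset2P => i i' j j'; have [->|ii'] := eqVneq i i'.
  by rewrite [X in _ - X]mulrC subrr dvdp0.
by apply: dvdp_sub; apply: dvd.
Qed.

Lemma component_diag_point s : (s + s <= k)%N -> (s < k)%N -> component s (diag_point s).
Proof.
move=> le2s s_lt; apply: (@Yset_leading_component _ _ _ _ _ _ ord0 ord0 s_lt) => //.
  exact: Yset_diag_point.
by rewrite /diag_point !eqxx oner_eq0.
Qed.

Lemma component_sub_inj s t : (2 <= m)%N -> (2 <= n)%N -> (0 < k)%N ->
  (s + s <= k)%N -> (t + t <= k)%N -> psubset (component s) (component t) -> s = t.
Proof.
move=> m2 n2 k_gt0 le2s le2t sub; have s_lt : (s < k)%N by lia.
have Wt := sub _ (component_diag_point le2s s_lt).
(* For [s < t] the entry 1 of the diagonal point at order [s] contradicts vanishing below order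
   [t]. *)
case: (ltngtP s t) => // st; exfalso.
  have [_ /(_ ord0 ord0 (Ordinal s_lt) st)] := component_sub_Yset le2t Wt.
  by rewrite /diag_point !eqxx => /eqP; rewrite oner_eq0.
(* For [t < s] the leading 3 x 3 minor of the diagonal point has order s + 2(k - s) = 2k - s, too
   small for component [t]. *)
have := @component_minor3 t (fun a => inord a) (fun a => inord a) (k + k - s)%N le2t _ _ Wt.
rewrite (_ : \matrix_(a, b) _ =
    diag_mx (\row_(a < 3) 'X^(diag_exp s a))); last first.
  apply/matrixP => a b; rewrite !mxE jet_diag_point.
  have ltm (e : 'I_3) : (e < m.+1)%N by have := ltn_ord e; lia.
  have ltn' (e : 'I_3) : (e < n.+1)%N by have := ltn_ord e; lia.
  rewrite !inordK // val_eqE; case: eqP => [->|_] /=; last by rewrite mulr0n.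
  by rewrite mulr1n ifT // /diag_exp; case: (val b); lia.
rewrite det_diag !big_ord_recl big_ord0 !mxE /= mulr1 -!exprD coefXn.
rewrite (_ : (_ == _) = true); last by lia.
by move=> H; have /eqP := H ltac:(lia); rewrite oner_eq0.
Qed.

(** The least order [s] of a nonzero coefficient selects component [s] when [s < k./2]; otherwise
    the point lies in [Yset] at [k./2], the last component. *)
Lemma Zset_cover x : (0 < k)%N ->
  Zset F m.+1 n.+1 k 2 x <-> exists2 s, (s < k./2.+1)%N & component s x.
Proof.
move=> k_gt0; split=> [Zx|[s les Ws]]; last first.
  by have [|//] := @component_sub_Yset F m n k s _ x Ws; lia.
pose nz s := [exists i, exists j, exists l : 'I_k, (l == s :> nat) && (x i j l != 0)].
have Yx s : (forall s', (s' < s)%N -> ~~ nz s') -> Yset F m.+1 n.+1 k s x.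
  move=> nz0; split=> // i j l /nz0/existsPn/(_ i)/existsPn/(_ j)/existsPn/(_ l).
  by rewrite eqxx /= negbK => /eqP.
have [[s0 /andP[s0_lt nz0]]|no] := classic (exists s, (s < k./2)%N && nz s).
  have ex : exists s, nz s by exists s0.
  have [s nzs min_s] := ex_minnP ex.
  have le_s := min_s _ nz0; exists s; first by lia.
  have s_lt : (s < k)%N by lia.
  have [i /existsP[j /existsP[l /andP[/eqP ls xl]]]] := existsP nzs.
  have l_s : l = Ordinal s_lt by apply: val_inj.
  rewrite l_s in xl; apply: Yset_leading_component xl; first by lia.
  by apply: Yx => s' lt_s'; apply/negP => /min_s; lia.
exists k./2 => //; rewrite -Yset_half_component //; apply: Yx => s' lt_s'.
by apply/negP => nzs'; apply: no; exists s'; rewrite lt_s'.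
Qed.

Lemma Zset_irredundant_cover : (2 <= m)%N -> (2 <= n)%N -> (0 < k)%N ->
  irredundant_cover k./2.+1 component (Zset F m.+1 n.+1 k 2).
Proof.
move=> m2 n2 k_gt0; split=> [s _|s t les let_|x].
- by split; [apply: irreducible_component | apply: zclosed_zclosure].
- by apply: component_sub_inj => //; lia.
exact: Zset_cover.
Qed.

End Decomposition.

Theorem theorem5p1 (F : closedFieldType) (m n k : nat) :
  (3 <= m)%N -> (m <= n)%N -> (2 <= k)%N ->
  let L := k./2 in
  ~ irreducible (Zset F m n k 2) /\
  (forall C, irr_component (Zset F m n k 2) C <->
     ((exists s, (s < L)%N /\ C = Xset F m n k s) \/ C = Yset F m n k L)) /\
  (forall s1 s2, (s1 < L)%N -> (s2 < L)%N ->
     Xset F m n k s1 = Xset F m n k s2 -> s1 = s2) /\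
  (forall s, (s < L)%N -> Xset F m n k s <> Yset F m n k L) /\
  (forall s, (s < L)%N ->
     has_codim (Xset F m n k s) ((m - 1) * (n - 1) * (k - 2 * s) + m * n * s)%N) /\
  has_codim (Yset F m n k L)
    (if odd k then ((m - 1) * (n - 1) + m * n * L)%N else (m * n * L)%N).
Proof.
case: m n => [//|m] [//|n] m3 mn k2 L.
have cover : irredundant_cover L.+1 (@component F m n k) (Zset F m.+1 n.+1 k 2).
  by apply: Zset_irredundant_cover; lia.
have [_ W_inj defZ] := cover.
have W_eq s t : (s <= L)%N -> (t <= L)%N ->
    @component F m n k s = @component F m n k t -> s = t.
  by move=> sL tL eqW; apply: W_inj => //; rewrite eqW.
have XW s : (s < L)%N -> Xset F m.+1 n.+1 k s = @component F m n k s.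
  by move=> sL; apply: Xset_component; rewrite /L in sL; lia.
have YW : Yset F m.+1 n.+1 k L = @component F m n k L by apply: Yset_half_component; lia.
split.
  (* An irreducible zero set would be its own component, hence a single [component s]; it contains
     those of index 0 and 1, both available as L is at least 1. *)
  move=> irrZ.
  have WZ s : (s <= L)%N -> psubset (@component F m n k s) (Zset F m.+1 n.+1 k 2).
    by move=> sL x Wx; apply/defZ; exists s.
  have compZ : irr_component (Zset F m.+1 n.+1 k 2) (Zset F m.+1 n.+1 k 2).
    by split=> //; split=> // D _ ZD DZ; apply: pset_ext.
  have /(irr_component_cover _ cover)[s sL defW] := compZ.
  have [s0 s1] : 0%N = s /\ 1%N = s.
    by split; apply: W_inj => //; rewrite -?defW; (try apply: WZ); rewrite /L; lia.
  by rewrite -s0 in s1.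
split.
  move=> C; rewrite (irr_component_cover _ cover) YW; split.
    move=> [s]; rewrite ltnS leq_eqVlt => /orP[/eqP->|sL] ->; first by right.
    by left; exists s; rewrite XW.
  move=> [[s [sL ->]]|->]; last by exists L.
  by exists s; [apply: ltnW | apply: XW].
split; first by move=> s t sL tL; rewrite !XW // => /W_eq; apply; apply: ltnW.
split.
  move=> s sL; rewrite XW // YW => /W_eq sLe; move: (sL).
  by rewrite sLe ?ltnn // ltnW.
rewrite !subn1 /=; split.
  by move=> s sL; rewrite XW //; apply: has_codim_component; rewrite /L in sL; lia.
(* [k - 2 * L] is 1 or 0 according to the parity of [k], so one formula covers both cases. *)
have -> : (if odd k then (m * n + m.+1 * n.+1 * L)%N else (m.+1 * n.+1 * L)%N) =
    (m * n * (k - 2 * L) + m.+1 * n.+1 * L)%N.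
  have := odd_double_half k; rewrite -/L -mul2n; case: (odd k) => /= <-.
    by rewrite addnK muln1.
  by rewrite add0n subnn muln0.
by rewrite YW; apply: has_codim_component; rewrite /L; lia.
Qed.
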